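(* Let $X=(\mathbb{C}^n,\|\cdot\|)$ be a complex normed space with a norm that is either a complex polytope norm with a real essential system of vertices or an adjoint complex polytope norm with a real essential system of facets. Suppose that $Y\subseteq X$ is a real subspace and $x\in X\setminus Y$ is a real vector (i.e. $x\in\mathbb{R}^n$), for which $y_0\in Y$ is a unique best approximation in $Y$. Then $y_0$ is a real vector and it is a $2$-strongly unique best approximation for $x$ in $Y$. Additionally, if $\|\cdot\|$ is an adjoint complex polytope norm (with a real essential system of facets), then $y_0$ is not an $\alpha$-strongly unique best approximation for $x$ in $Y$ for any $\alpha<2$ (where $\alpha\ge1$).
   Context: Throughout $n\ge2$ and ''subspace'' means a proper nonzero linear subspace. For $u_1,\dots,u_N\in\mathbb{C}^n$ put $\operatorname{absconv}\{u_1,\dots,u_N\}=\{\sum_j\alpha_ju_j:\ \alpha_j\in\mathbb{C},\ \sum_j|\alpha_j|\le 1\}$. A norm on $\mathbb{C}^n$ is a complex polytope norm if its closed unit ball equals $\operatorname{absconv}\{u_1,\dots,u_N\}$ for some vectors $u_1,\dots,u_N\in\mathbb{C}^n$; a minimal such set of vectors is an essential system of vertices (unique up to permutation and multiplication by scalars of modulus $1$), and it is real if all $u_j\in\mathbb{R}^n$. A norm on $\mathbb{C}^n$ is an adjoint complex polytope norm if $\|x\|=\max_{1\le j\le N}|f_j(x)|$ for all $x\in\mathbb{C}^n$, for some linear functionals $f_1,\dots,f_N:\mathbb{C}^n\to\mathbb{C}$; a minimal such set of functionals is an essential system of facets, and it is real if every $f_j$ maps $\mathbb{R}^n$ into $\mathbb{R}$.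 A linear subspace of $\mathbb{C}^n$ is a real subspace if it has a basis (over $\mathbb{C}$) consisting of vectors in $\mathbb{R}^n$. A vector $y_0\in Y$ is a best approximation for $x$ in $Y$ if $\|x-y\|\ge\|x-y_0\|$ for all $y\in Y$; it is unique if no other element of $Y$ has this property. For a real $\alpha\ge1$, $y_0\in Y$ is an $\alpha$-strongly unique best approximation for $x$ in $Y$ if there is $r>0$ with $\|x-y\|^\alpha\ge\|x-y_0\|^\alpha+r\|y-y_0\|^\alpha$ for all $y\in Y$. *)

(* Defs.v *)
From HB Require Import structures.
From mathcomp Require Import all_boot all_order all_algebra.
From mathcomp Require Import complex.
From mathcomp Require Import reals exp.

Set Implicit Arguments.
Unset Strict Implicit.
Unset Printing Implicit Defensive.

Import Order.TTheory GRing.Theory Num.Theory.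

Local Open Scope ring_scope.

(* [Normc.normc] is the modulus as an element of [R] (the generic
   [`|z|] on [R[i]] is valued in [R[i]]). *)
Notation modulus := Normc.normc.

Section ComplexPolytopeNorms.
Variables (R : realType) (n : nat).
Local Notation C := (R[i]).
Local Notation V := 'rV[C]_n.
Implicit Types (nrm : V -> R) (Y : {vspace V}) (x y : V).

Definition is_norm nrm : Prop :=
  [/\ forall x, 0 <= nrm x,
      forall x, nrm x = 0 -> x = 0,
      forall (a : C) x, nrm (a *: x) = modulus a * nrm x
    & forall x y, nrm (x + y) <= nrm x + nrm y].

(* On [R[i]], [Num.real] consists of the numbers with zero imaginary part. *)
Definition real_vector x : Prop := x \is a mxOver Num.real.

Definition real_functional (f : {scalar V}) : Prop :=
  forall x, real_vector x -> f x \is Num.real.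

Definition real_subspace Y : Prop :=
  exists b : seq V, basis_of Y b /\ (forall v, v \in b -> real_vector v).

(* The families below are indexed by ['I_N] and restricted to a set [A] of
   indices, so that minimality of a system can be expressed; a minimal family
   is automatically free of repetitions. *)

Definition absconv N (u : 'I_N -> V) (A : {set 'I_N}) x : Prop :=
  exists2 a : 'I_N -> C,
    \sum_(j in A) modulus (a j) <= 1 & x = \sum_(j in A) a j *: u j.

Definition unit_ball_absconv nrm N (u : 'I_N -> V) (A : {set 'I_N}) : Prop :=
  forall x, nrm x <= 1 <-> absconv u A x.

Definition complex_polytope_norm nrm : Prop :=
  exists N (u : 'I_N -> V), unit_ball_absconv nrm u setT.

Definition essential_vertices nrm N (u : 'I_N -> V) : Prop :=
  unit_ball_absconv nrm u setT /\
  (forall A : {set 'I_N}, unit_ball_absconv nrm u A -> A = setT).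

Definition has_real_essential_vertices nrm : Prop :=
  exists N (u : 'I_N -> V),
    essential_vertices nrm u /\ (forall j, real_vector (u j)).

(* The default value 0 of the maximum is harmless, as moduli are nonnegative. *)
Definition norm_max_functionals nrm N (f : 'I_N -> {scalar V})
    (A : {set 'I_N}) : Prop :=
  forall x, nrm x = \big[Num.max/0]_(j in A) modulus (f j x).

Definition adjoint_complex_polytope_norm nrm : Prop :=
  exists N (f : 'I_N -> {scalar V}), norm_max_functionals nrm f setT.

Definition essential_facets nrm N (f : 'I_N -> {scalar V}) : Prop :=
  norm_max_functionals nrm f setT /\
  (forall A : {set 'I_N}, norm_max_functionals nrm f A -> A = setT).

Definition has_real_essential_facets nrm : Prop :=
  exists N (f : 'I_N -> {scalar V}),
    essential_facets nrm f /\ (forall j, real_functional (f j)).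

Definition best_approximation nrm Y x y0 : Prop :=
  y0 \in Y /\ (forall y, y \in Y -> nrm (x - y) >= nrm (x - y0)).

Definition unique_best_approximation nrm Y x y0 : Prop :=
  best_approximation nrm Y x y0 /\
  (forall y, best_approximation nrm Y x y -> y = y0).

(* For real alpha >= 1; [powR] satisfies [0 `^ alpha = 0] when alpha != 0. *)
Definition strongly_unique_best_approximation nrm (alpha : R) Y x y0 : Prop :=
  y0 \in Y /\
  exists2 r : R, 0 < r &
    forall y, y \in Y ->
      nrm (x - y) `^ alpha >= nrm (x - y0) `^ alpha + r * nrm (y - y0) `^ alpha.

End ComplexPolytopeNorms.

(* Main.v *)
(* Complex conjugation is an isometry, so uniqueness forces [y0] to be real, and
   one may take [y0 = 0], [x] real of norm [d > 0]; write [y = a + i b] with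
   [a], [b] real vectors of [Y]. Both estimates rest on strict complementarity
   for linear inequalities.
   Facets: uniqueness says that no nonzero real [a] in [Y] satisfies
   [f_j(x) f_j(a) >= 0] for all active [j], i.e. all those with
   [|f_j(x)| = d], so some positive combination [\sum c_j f_j(x) f_j] over the
   active [j] vanishes on [Y]. Averaging
   [|f_j(x - y)|^2 = (f_j(x) - f_j(a))^2 + f_j(b)^2] with the weights [c_j]
   then yields [||x - y||^2 >= d^2 + r ||y||^2]. Conversely
   [||x - i t b||^2 <= d^2 + t^2 ||b||^2], which excludes exponents below 2.
   Vertices: there is a real functional vanishing on [Y], supporting the ball
   at [x], whose exposed face has a vertex set [F] with
   [span F :&: Y = 0]. If [x - y = \sum z_j u_j], then
   [\sum |z_j| - d] dominates the sum of [|z_j|] over the vertices outside [F],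
   and that sum dominates [||y||]; this even gives exponent 1. *)
Require Import Defs.
From mathcomp Require Import all_boot all_order all_algebra.
From mathcomp Require Import complex.
From mathcomp Require Import boolp reals exp.
From mathcomp Require Import ring lra.

Set Implicit Arguments.
Unset Strict Implicit.
Unset Printing Implicit Defensive.

Import Order.TTheory GRing.Theory Num.Theory.

Local Open Scope ring_scope.

(** * Linear inequalities *)

Section Alternatives.
Variables (R : realFieldType) (V : lmodType R).

Lemma scalar_lincomb (f : V -> R) (J : finType) (c : J -> R) (v : J -> V) :
  scalar f -> f (\sum_j c j *: v j) = \sum_j c j * f (v j).
Proof.
move=> lf; have f0 : f 0 = 0.
  by have := lf (-1) 0 0; rewrite scaler0 addr0 mulN1r addNr.
by elim/big_rec2: _ => // j x y _ <-; rewrite lf.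
Qed.

(* Induction on the number of functionals. If the last one [a i] is needed,
   some [v0] violates the conclusion for the others, [a i v0 > 0], and the
   projection along [v0] onto the kernel of [a i] reduces to the others. *)
Lemma farkas (I : eqType) (r : seq I) (a : I -> V -> R) (b : V -> R) :
  uniq r -> (forall i, scalar (a i)) -> scalar b ->
  (forall v, (forall i, i \in r -> a i v <= 0) -> b v <= 0) ->
  exists2 c : I -> R, (forall i, 0 <= c i) &
    forall v, b v = \sum_(i <- r) c i * a i v.
Proof.
elim: r a b => [|i r IH] a b /=.
  move=> _ _ lb bP; exists (fun=> 0) => // v; rewrite big_nil.
  apply/eqP; rewrite eq_le bP //= -oppr_le0.
  have b0 : b 0 = 0.
    by have := lb (-1) 0 0; rewrite scaler0 addr0 mulN1r addNr.
  by have := lb (-1) v 0; rewrite addr0 mulN1r b0 addr0 => <-; apply: bP.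
move=> /andP[ir ur] la lb bP.
have [bP'|] := pselect (forall v, (forall j, j \in r -> a j v <= 0) -> b v <= 0).
  have [c c0 cE] := IH a b ur la lb bP'.
  exists (fun j => if j == i then 0 else c j) => [j|v]; first by case: ifP.
  rewrite big_cons eqxx mul0r add0r cE; apply: eq_big_seq => j jr.
  by case: eqP => // ji; rewrite -ji jr in ir.
move=> /existsNP[v0 /not_implyP[av0 /negP]]; rewrite -ltNge => bv0.
have aiv0 : 0 < a i v0.
  rewrite ltNge; apply/negP => aiv0; move: bv0; rewrite ltNge bP// => j.
  by rewrite inE => /orP[/eqP->//|/av0].
pose t v := a i v / a i v0.
have tl : scalar t by move=> k u v; rewrite /t la mulrDl mulrA.
pose pr v := v - t v *: v0.
have prl k u v : pr (k *: u + v) = k *: pr u + pr v.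
  rewrite /pr tl scalerBr scalerDl scalerA opprD !addrA; congr (_ + _).
  by rewrite -!addrA; congr (_ + _); rewrite addrC.
have prE f : scalar f -> forall v, f (pr v) = f v - t v * f v0.
  by move=> lf v; rewrite /pr -scaleNr [_ + _ *: _]addrC lf mulNr addrC.
have [||v Pv|c c0 cE] := IH (fun j v => a j (pr v)) (fun v => b (pr v)) ur.
- by move=> j k u v; rewrite prl la.
- by move=> k u v; rewrite prl lb.
- apply: bP => j; rewrite inE => /orP[/eqP->|/Pv//].
  by rewrite prE// /t divfK ?subrr// gt_eqF.
pose s := b v0 - \sum_(j <- r) c j * a j v0.
have s0 : 0 <= s.
  rewrite subr_ge0 (le_trans _ (ltW bv0))//.
  rewrite -oppr_ge0 -sumrN big_seq sumr_ge0// => j jr.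
  by rewrite -mulrN mulr_ge0// oppr_ge0 av0.
exists (fun j => if j == i then s / a i v0 else c j) => [j|v].
  by case: ifP => // _; rewrite divr_ge0// ltW.
rewrite big_cons eqxx.
have -> : \sum_(j <- r) (if j == i then s / a i v0 else c j) * a j v
  = \sum_(j <- r) c j * a j v.
  by apply: eq_big_seq => j jr; case: eqP => // ji; rewrite -ji jr in ir.
have := cE v; rewrite prE//.
under eq_bigr => j _ do rewrite prE// mulrBr mulrCA.
rewrite big_split/= sumrN -mulr_sumr => /eqP; rewrite subr_eq => /eqP ->.
have -> : s / a i v0 * a i v = t v * s by rewrite /t; ring.
by rewrite /s; ring.
Qed.

(* Tucker's strict complementarity: sum, over [i], solutions of the pair of
   systems that are strict at the index [i]. *)
Lemma tucker (I : finType) (a : I -> V -> R) : (forall i, scalar (a i)) ->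
  exists (v : V) (c : I -> R),
    [/\ forall i, 0 <= c i, forall w, \sum_i c i * a i w = 0,
        forall i, 0 <= a i v & forall i, 0 < a i v + c i].
Proof.
move=> la.
have step i : exists p : V * (I -> R),
    [/\ forall j, 0 <= p.2 j, forall w, \sum_j p.2 j * a j w = 0,
        forall j, 0 <= a j p.1 & 0 < a i p.1 + p.2 i].
  have a0 j : a j 0 = 0.
    by have := la j (-1) 0 0; rewrite scaler0 addr0 mulN1r addNr.
  have [[v [av aiv]]|nv] :=
    pselect (exists v, (forall j, 0 <= a j v) /\ 0 < a i v).
    exists (v, fun=> 0); split => //= [w|]; last by rewrite addr0.
    by rewrite big1// => j _; rewrite mul0r.
  have [|v vP|c c0 cE] :=
      @farkas _ (enum I) (fun j v => - a j v) (a i) (enum_uniq _) _ (la i).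
  - by move=> j k u v; rewrite la opprD mulrN.
  - rewrite leNgt; apply/negP => aiv; apply: nv; exists v; split=> // j.
    by rewrite -oppr_le0 vP// mem_enum.
  exists (0, fun j => c j + (j == i)%:R) => /=; split => //.
  - by move=> j; rewrite addr_ge0.
  - move=> w; under eq_bigr => j _ do rewrite mulrDl.
    rewrite big_split/= (bigD1 i (P := xpredT) (F := fun j => _%:R * _))//=.
    rewrite eqxx mul1r cE [in X in _ + (_ + X)]big1 => [|j /negPf->]; last first.
      by rewrite mul0r.
    rewrite addr0 big_enum/= -big_split big1// => j _.
    by rewrite mulrN; apply: addrN.
  - by move=> j; rewrite a0.
  - by rewrite a0 add0r eqxx ltr_wpDl.
have [p pP] := choice step.
exists (\sum_i (p i).1), (fun j => \sum_i (p i).2 j).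
have aE j : a j (\sum_i (p i).1) = \sum_i a j (p i).1.
  rewrite -[RHS](eq_bigr _ (fun _ _ => mul1r _)) -scalar_lincomb//.
  by congr a; apply: eq_bigr => i _; rewrite scale1r.
split => [j|w|j|j].
- by apply: sumr_ge0 => i _; have [+ _ _ _] := pP i; apply.
- under eq_bigr do rewrite mulr_suml.
  by rewrite exchange_big big1// => i _; have [_ + _ _] := pP i; apply.
- by rewrite aE; apply: sumr_ge0 => i _; have [_ _ + _] := pP i; apply.
- rewrite aE -big_split (bigD1 j)//= ltr_pwDl//; first by have [] := pP j.
  by apply: sumr_ge0 => i _; have [? _ ? _] := pP i; rewrite addr_ge0.
Qed.

End Alternatives.

(** * Finite families and factorization of linear maps *)

Section Finite.
Variables (R : realFieldType) (I : finType).

(** With [P i t] read as [t <= c i], this also gives positive numbers [c i] a common positive lower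
    bound. *)
Lemma uniform_threshold (P : I -> R -> Prop) :
  (forall i, exists2 e, 0 < e & forall t, 0 <= t <= e -> P i t) ->
  exists2 e, 0 < e & forall i t, 0 <= t <= e -> P i t.
Proof.
move=> eP; have /choice[e {}eP] : forall i, exists e, 0 < e /\
    forall t, 0 <= t <= e -> P i t by move=> i; have [e] := eP i; exists e.
have m0 : 0 < \big[Num.min/1]_i e i.
  by apply: lt_bigmin => // i _; have [] := eP i.
exists (\big[Num.min/1]_i e i) => // i t /andP[t0 te].
by have [_] := eP i; apply; rewrite t0 (le_trans te)// bigmin_le.
Qed.

(** Cauchy-Schwarz against a constant family, from [2 |t i| |t j| <= t i ^+ 2 + t j ^+ 2] summed
    over all pairs. *)
Lemma sqr_sum_norm_le (t : I -> R) :
  (\sum_i `|t i|) ^+ 2 <= #|I|%:R * \sum_i t i ^+ 2.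
Proof.
have -> : #|I|%:R * \sum_i t i ^+ 2 =
    \sum_i \sum_j (t i ^+ 2 / 2 + t j ^+ 2 / 2).
  under [RHS]eq_bigr do rewrite big_split/= sumr_const.
  rewrite big_split/= sumr_const sumrMnl -mulr_suml -mulrnDl.
  by rewrite -splitr mulr_natl.
rewrite expr2 mulr_suml ler_sum// => i _.
rewrite mulr_sumr ler_sum// => j _.
rewrite -(real_normK (num_real (t i))) -(real_normK (num_real (t j))).
have := sqr_ge0 (`|t i| - `|t j|); nra.
Qed.

End Finite.

(** The rows of [1 - A *m pinvmx A] lie in the left kernel of [A], hence in that of [B]. Together
    with [nrm_mulmx_bound], the factor [T] does the work of a compactness argument. *)
Lemma kermx_sub_factor (F : fieldType) (m n p : nat)
    (A : 'M[F]_(m, n)) (B : 'M[F]_(m, p)) :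
  (forall v : 'rV_m, v *m A = 0 -> v *m B = 0) -> exists T, B = A *m T.
Proof.
move=> AB; exists (pinvmx A *m B); apply/eqP.
rewrite mulmxA -subr_eq0 -[X in X - _]mul1mx -mulmxBl; apply/eqP/row_matrixP => i.
rewrite row_mul row0; apply: AB.
by rewrite -row_mul mulmxBl mul1mx mulmxKpV// subrr row0.
Qed.

(** * Real and imaginary parts *)

Section ComplexVectors.
Variable R : realType.
Local Notation C := R[i].

(** The vector [p + i q]; this form lets the linear algebra run over [R]. *)
Definition cvec n (p q : 'rV[R]_n) : 'rV[C]_n := map2_mx (@Complex R) p q.

Lemma cvecK n (v : 'rV[C]_n) :
  v = cvec (map_mx (@complex.Re R) v) (map_mx (@complex.Im R) v).
Proof. by apply/rowP => j; rewrite !mxE; case: (v 0 j). Qed.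

Lemma cvecP n (v : 'rV[C]_n) : exists p q, v = cvec p q.
Proof. by exists (map_mx (@complex.Re R) v), (map_mx (@complex.Im R) v); exact: cvecK. Qed.

Lemma cvec_inj n (p q p' q' : 'rV[R]_n) :
  cvec p q = cvec p' q' -> p = p' /\ q = q'.
Proof.
move=> /rowP E; split; apply/rowP => j; have := E j; rewrite !mxE; by case.
Qed.

Lemma cvecD n (p q p' q' : 'rV[R]_n) :
  cvec p q + cvec p' q' = cvec (p + p') (q + q').
Proof. by apply/rowP => j; rewrite !mxE. Qed.

Lemma cvecN n (p q : 'rV[R]_n) : - cvec p q = cvec (- p) (- q).
Proof. by apply/rowP => j; rewrite !mxE. Qed.

Lemma cvecB n (p q p' q' : 'rV[R]_n) :
  cvec p q - cvec p' q' = cvec (p - p') (q - q').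
Proof. by rewrite cvecN cvecD. Qed.

Lemma cvecZ n (t : R) (p q : 'rV[R]_n) :
  Complex t 0 *: cvec p q = cvec (t *: p) (t *: q).
Proof.
by apply/rowP => j; rewrite !mxE; congr Complex; rewrite !mul0r ?subr0 ?addr0.
Qed.

Lemma cvec00 n : cvec 0 0 = 0 :> 'rV[C]_n.
Proof. by apply/rowP => j; rewrite !mxE. Qed.

Lemma cvec_split n (p q : 'rV[R]_n) :
  cvec p q = Complex 0 1 *: cvec q 0 + cvec p 0.
Proof.
apply/rowP => j; rewrite !mxE; congr Complex => /=; ring.
Qed.

Lemma real_cvec n (p q : 'rV[R]_n) : real_vector (cvec p q) <-> q = 0.
Proof.
split=> [/mxOverP qr|->].
  apply/rowP => j; rewrite mxE; have := qr 0 j.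
  by rewrite mxE complex_real => /eqP.
by apply/mxOverP => i j; rewrite !mxE complex_real.
Qed.

Lemma cvec_mulmx m n (c d : 'rV[R]_m) (T : 'M[R]_(m, n)) :
  cvec (c *m T) (d *m T) = \sum_j Complex (c 0 j) (d 0 j) *: cvec (row j T) 0.
Proof.
apply/rowP => l; rewrite summxE !mxE.
apply/eqP; rewrite eq_complex/=; apply/andP; split; apply/eqP.
  rewrite (big_morph (@complex.Re R) (id1 := 0) (op1 := +%R))//; last by case=> ? ? [].
  by apply: eq_bigr => j _; rewrite !mxE/=; ring.
rewrite (big_morph (@complex.Im R) (id1 := 0) (op1 := +%R))//; last by case=> ? ? [].
by apply: eq_bigr => j _; rewrite !mxE/=; ring.
Qed.

Lemma sqr_modulus (a b : R) : modulus (Complex a b) ^+ 2 = a ^+ 2 + b ^+ 2.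
Proof. by rewrite /= sqr_sqrtr// addr_ge0// sqr_ge0. Qed.

Lemma modulus_ge0 (z : C) : 0 <= modulus z.
Proof. by case: z => a b; apply: sqrtr_ge0. Qed.

Lemma modulus_real (a : R) : modulus (Complex a 0) = `|a|.
Proof. by rewrite /= expr0n addr0 sqrtr_sqr. Qed.

Lemma norm_Re_le_modulus (z : C) : `|complex.Re z| <= modulus z.
Proof.
case: z => a b /=; rewrite -sqrtr_sqr ler_sqrt ?addr_ge0 ?sqr_ge0//.
by rewrite lerDl sqr_ge0.
Qed.

(** The rows of [B] form a real basis of [Y], and complex coordinates split as [a + i b]. *)
Lemma real_subspace_mx n (Y : {vspace 'rV[C]_n}) : real_subspace Y ->
  exists k (B : 'M[R]_(k, n)), forall y,
    y \in Y <-> exists a b, y = cvec (a *m B) (b *m B).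
Proof.
move=> [s [/andP[/eqP <- _] sr]].
pose B := \matrix_(i < size s) map_mx (@complex.Re R) s`_i.
have BE (i : 'I_(size s)) : cvec (row i B) 0 = s`_i.
  rewrite rowK; have := sr s`_i (mem_nth 0 (ltn_ord i)).
  by rewrite {1}[s`_i]cvecK => /real_cvec <-; exact/esym/cvecK.
exists (size s), B => y; split=> [ys|[a [b ->]]].
  exists (\row_i complex.Re (coord (in_tuple s) i y)).
  exists (\row_i complex.Im (coord (in_tuple s) i y)).
  rewrite cvec_mulmx [LHS](coord_span (X := in_tuple s))//.
  by apply: eq_bigr => i _; rewrite !mxE BE; case: coord.
rewrite cvec_mulmx; apply: memv_suml => i _; apply: memvZ.
by rewrite BE memv_span// mem_nth.
Qed.

End ComplexVectors.

Section Norm.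
Variables (R : realType) (n : nat) (nrm : 'rV[R[i]]_n -> R).
Hypothesis hnrm : is_norm nrm.

Lemma nrm_ge0 v : 0 <= nrm v. Proof. by case: hnrm. Qed.

Lemma nrm0 : nrm 0 = 0.
Proof. by have [_ _ h _] := hnrm; rewrite -(scale0r 0) h Normc.normc0 mul0r. Qed.

Lemma nrm_gt0 v : v != 0 -> 0 < nrm v.
Proof.
move=> v0; rewrite lt_neqAle nrm_ge0 andbT eq_sym.
by apply: contra_neq v0; case: hnrm => _ + _ _; apply.
Qed.

Lemma nrmZ (a : R[i]) v : nrm (a *: v) = modulus a * nrm v.
Proof. by case: hnrm. Qed.

Lemma nrm_cvecZ (t : R) (p q : 'rV[R]_n) :
  nrm (cvec (t *: p) (t *: q)) = `|t| * nrm (cvec p q).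
Proof. by rewrite -cvecZ nrmZ modulus_real. Qed.

Lemma nrmN v : nrm (- v) = nrm v.
Proof. by rewrite -scaleN1r nrmZ normcN Normc.normc1 mul1r. Qed.

Lemma nrm_sum (I : finType) (v : I -> 'rV[R[i]]_n) :
  nrm (\sum_i v i) <= \sum_i nrm (v i).
Proof.
elim/big_ind2: _ => [|s u t w us wt|//]; first by rewrite nrm0.
by case: hnrm => _ _ _ h; rewrite (le_trans (h _ _))// lerD.
Qed.

Lemma nrm_mulmx_bound m (T : 'M[R]_(m, n)) : exists2 K, 0 < K &
  forall c d : 'rV[R]_m,
    nrm (cvec (c *m T) (d *m T)) <= K * \sum_j modulus (Complex (c 0 j) (d 0 j)).
Proof.
exists (1 + \sum_j nrm (cvec (row j T) 0)) => [|c d].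
  by rewrite ltr_pwDl// sumr_ge0// => j _; apply: nrm_ge0.
rewrite cvec_mulmx (le_trans (nrm_sum _))// mulr_sumr ler_sum// => j _.
rewrite nrmZ mulrC ler_wpM2r ?modulus_ge0// (bigD1 j)//= addrCA lerDl.
by rewrite addr_ge0// sumr_ge0// => l _; apply: nrm_ge0.
Qed.

End Norm.

(** * Real systems of facets *)

Section Facets.
Variables (R : realType) (n N : nat) (nrm : 'rV[R[i]]_n -> R).
Hypothesis hnrm : is_norm nrm.
Variable f : 'I_N -> {scalar 'rV[R[i]]_n}.
Hypothesis hf : norm_max_functionals nrm f setT.
Hypothesis fr : forall j, real_functional (f j).

Definition re_functional (j : 'I_N) (p : 'rV[R]_n) : R := complex.Re (f j (cvec p 0)).
Local Notation g := re_functional.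

Lemma functional_cvec j p q : f j (cvec p q) = Complex (g j p) (g j q).
Proof.
have E u : f j (cvec u 0) = Complex (g j u) 0.
  have : f j (cvec u 0) \is Num.real by apply: fr; apply/real_cvec.
  rewrite /g; case: (f j _) => a b; rewrite complex_real => /eqP ->.
  by [].
rewrite cvec_split linearP !E; congr Complex => /=; ring.
Qed.

Lemma re_functional_scalar j : scalar (g j).
Proof.
move=> t u v; rewrite {1}/g.
have -> : cvec (t *: u + v) 0 = Complex t 0 *: cvec u 0 + cvec v 0.
  by rewrite cvecZ cvecD scaler0 addr0.
rewrite linearP !functional_cvec /=; ring.
Qed.

Lemma facet_le j v : modulus (f j v) <= nrm v.
Proof. by rewrite hf (le_bigmax_cond _ (fun j => modulus (f j v)))// in_setT. Qed.

Lemma facets_nrm_le v (t : R) : 0 <= t ->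
  (forall j, modulus (f j v) <= t) -> nrm v <= t.
Proof. by move=> t0 h; rewrite hf; apply: bigmax_le. Qed.

(** Each [|f_j (p + i q)|] is the square root of [g j p ^+ 2 + g j q ^+ 2], which ignores the sign
    of [q]. *)
Lemma facets_nrm_conj p q : nrm (cvec p (- q)) = nrm (cvec p q).
Proof.
rewrite !hf; apply: eq_bigr => j _; rewrite !functional_cvec.
have := re_functional_scalar j (-1) q 0.
have := re_functional_scalar j (-1) 0 0.
rewrite scaler0 scaleN1r !addr0 => E1 E2.
by rewrite E2 /= !sqrrD; congr Num.sqrt; nra.
Qed.

End Facets.

(** * Real facets: quadratic growth and its sharpness *)

Section FacetsStrong.
Variables (R : realType) (n N : nat) (nrm : 'rV[R[i]]_n -> R).
Hypothesis hnrm : is_norm nrm.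
Variable f : 'I_N -> {scalar 'rV[R[i]]_n}.
Hypothesis hf : norm_max_functionals nrm f setT.
Hypothesis fr : forall j, real_functional (f j).
Local Notation g := (re_functional f).

Lemma re_functional0 j : g j 0 = 0.
Proof.
by have := re_functional_scalar fr j (-1) 0 0; rewrite scaler0 addr0 mulN1r addNr.
Qed.

Lemma re_functionalZ j t p : g j (t *: p) = t * g j p.
Proof.
by have := re_functional_scalar fr j t p 0; rewrite !addr0 re_functional0 addr0.
Qed.

Lemma re_functionalB j p q : g j (p - q) = g j p - g j q.
Proof.
by rewrite -scaleN1r addrC re_functional_scalar// mulN1r addrC.
Qed.

Lemma re_functionalN j p : g j (- p) = - g j p.
Proof. by rewrite -scaleN1r re_functionalZ mulN1r. Qed.

Lemma sqr_facet_le j p q : g j p ^+ 2 + g j q ^+ 2 <= nrm (cvec p q) ^+ 2.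
Proof.
rewrite -sqr_modulus -functional_cvec// lerXn2r ?nnegrE ?modulus_ge0 ?nrm_ge0//.
exact: facet_le.
Qed.

Lemma real_facet_le j p : `|g j p| <= nrm (cvec p 0).
Proof.
rewrite -modulus_real; apply: le_trans (facet_le hf j _).
by rewrite functional_cvec// re_functional0.
Qed.

Variables (k : nat) (B : 'M[R]_(k, n)) (x0 : 'rV[R]_n).
Variable d : R.
Hypothesis dE : d = nrm (cvec x0 0).
Hypothesis d_gt0 : 0 < d.

Section Strong.
Hypothesis huniq : forall a, nrm (cvec (x0 - a *m B) 0) <= d -> a *m B = 0.
Hypothesis hmin : forall a b, d <= nrm (cvec (x0 - a *m B) (- (b *m B))).

Let active j := `|g j x0| == d.
Let s j := if active j then g j x0 else 0.

(** Along [x0 - t *: (v *m B)] with small [t >= 0], the active values move toward zero without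
    crossing it, and the inactive ones have slack. The distance stays at most [d], so uniqueness
    applies. *)
Lemma no_descent_direction v : (forall j, 0 <= s j * g j (v *m B)) -> v *m B = 0.
Proof.
move=> sv.
have [j|e e0 eP] := @uniform_threshold R 'I_N
    (fun j t => `|g j x0 - t * g j (v *m B)| <= d).
  have := sv j; rewrite /s; case: ifP => [/eqP Gd GH|/negbT Gd _].
    exists (d / (1 + `|g j (v *m B)|)) => [|t /andP[t0]].
      by rewrite divr_gt0// ltr_pwDl.
    rewrite ler_pdivlMr ?ltr_pwDl// => te; rewrite ler_norml.
    have tH : `|t * g j (v *m B)| <= d.
      by rewrite normrM (ger0_norm t0); nra.
    move: tH; rewrite ler_norml => /andP[tH1 tH2].
    have [G0|G0] := leP 0 (g j x0).
      rewrite ger0_norm// in Gd; rewrite Gd in GH *.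
      move: GH; rewrite pmulr_rge0// => /(mulr_ge0 t0) ?.
      by apply/andP; split; lra.
    rewrite ltr0_norm// in Gd.
    move: GH; rewrite nmulr_rge0// => /(mulr_ge0_le0 t0) ?.
    by apply/andP; split; lra.
  have {}Gd : 0 < d - `|g j x0| by rewrite subr_gt0 lt_neqAle Gd dE real_facet_le.
  exists ((d - `|g j x0|) / (1 + `|g j (v *m B)|)) => [|t /andP[t0]].
    by rewrite divr_gt0// ltr_pwDl.
  rewrite ler_pdivlMr ?ltr_pwDl// => te.
  rewrite (le_trans (ler_normB _ _))// normrM (ger0_norm t0); nra.
have : e *: v *m B = 0.
  apply: huniq; apply: (facets_nrm_le hf); first exact: ltW.
  move=> j; rewrite functional_cvec// re_functional0 modulus_real re_functionalB.
  by rewrite -scalemxAl re_functionalZ eP// lexx ltW.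
by move/eqP; rewrite -scalemxAl scaler_eq0 gt_eqF//= => /eqP.
Qed.

(* The multipliers [c j > 0] annihilate the first-order term of
   [\sum_j c j * |f_j (x - y)|^2], which leaves a positive definite quadratic
   form in [y]. *)
Lemma facets_strong : exists2 r, 0 < r & forall a b,
  d ^+ 2 + r * nrm (cvec (a *m B) (b *m B)) ^+ 2
    <= nrm (cvec (x0 - a *m B) (- (b *m B))) ^+ 2.
Proof.
have [|v [c [c0 cE av ac]]] := @tucker R 'rV[R]_k 'I_N (fun j v => s j * g j (v *m B)).
  move=> j t u v; rewrite mulmxDl -scalemxAl (re_functional_scalar fr); ring.
(* The primal half of Tucker's pair vanishes, so strictness makes every multiplier positive. *)
have vB := no_descent_direction av.
have c_gt0 j : 0 < c j by have := ac j; rewrite vB re_functional0 mulr0 add0r.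
have [j|e e0 eP] := @uniform_threshold R 'I_N (fun j t => t <= c j).
  by exists (c j) => // t /andP[].
have {}eP j : e <= c j by apply: eP; rewrite lexx ltW.
pose M := \matrix_(l < k, j < N) if active j then g j (row l B) else 0.
have ME a j : (a *m M) 0 j = if active j then g j (a *m B) else 0.
  rewrite !mxE mulmx_sum_row scalar_lincomb; last exact: re_functional_scalar.
  under eq_bigr do rewrite mxE; case: ifP => _ //.
  by rewrite big1// => l _; rewrite mulr0.
(* A vector of [Y] killed by all active functionals is zero, so [y] is a linear function of its
   active values. *)
have [u uM|T BE] := @kermx_sub_factor R k N n M B.
  apply: no_descent_direction => j; rewrite /s; case: ifP => aj.
    by have := ME u j; rewrite uM aj mxE => <-; rewrite mulr0.
  by rewrite mul0r.
have [K K0 KP] := nrm_mulmx_bound hnrm T.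
pose L := \sum_j c j.
have L0 : 0 <= L by apply: sumr_ge0.
pose D := K ^+ 2 * N%:R + 1.
have D0 : 0 < D by rewrite ltr_wpDl// mulr_ge0// sqr_ge0.
(* Obtained from [e * Q <= L * (t ^+ 2 - d ^+ 2)] and [h ^+ 2 <= D * Q]; the added ones in [L + 1]
   and [D] ensure positivity. *)
exists (e / ((L + 1) * D)) => [|a b].
  by rewrite divr_gt0// mulr_gt0// ltr_wpDl.
set h := nrm (cvec (a *m B) _); set t := nrm (cvec (_ - _) _).
have dt : d ^+ 2 <= t ^+ 2 by rewrite lerXn2r ?nnegrE ?nrm_ge0 ?(ltW d_gt0) ?hmin.
pose Q := \sum_j ((a *m M) 0 j ^+ 2 + (b *m M) 0 j ^+ 2).
have Q0 : 0 <= Q by apply: sumr_ge0 => j _; rewrite addr_ge0// sqr_ge0.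
have hQ : h ^+ 2 <= D * Q.
  pose z j := modulus (Complex ((a *m M) 0 j) ((b *m M) 0 j)).
  have hz : h <= K * \sum_j `|z j|.
    rewrite /h {1 2}BE !mulmxA (le_trans (KP _ _))//.
    by under [X in _ <= _ * X]eq_bigr do rewrite ger0_norm ?modulus_ge0//.
  have zQ := sqr_sum_norm_le z; rewrite card_ord in zQ.
  have QE : \sum_j z j ^+ 2 = Q by apply: eq_bigr => j _; rewrite sqr_modulus.
  rewrite QE in zQ.
  have h0 : 0 <= h := nrm_ge0 hnrm _.
  have : h ^+ 2 <= (K * \sum_j `|z j|) ^+ 2.
    by rewrite lerXn2r ?nnegrE ?mulr_ge0 ?sumr_ge0// ltW.
  rewrite exprMn => /le_trans -> //.
  rewrite (le_trans (ler_wpM2l (sqr_ge0 K) zQ))// /D mulrDl mul1r mulrA.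
  by rewrite lerDl.
have main : L * d ^+ 2 + e * Q <= L * t ^+ 2.
  (* For active [j] this expands the square and uses [e <= c j]; for inactive [j] it reduces to
     [d <= t]. The linear terms cancel in the sum by [cE a]. *)
  have term j : c j * d ^+ 2 + e * ((a *m M) 0 j ^+ 2 + (b *m M) 0 j ^+ 2)
      - 2 * (c j * (s j * g j (a *m B))) <= c j * t ^+ 2.
    rewrite !ME /s; case: ifP => [/eqP gd|_]; last first.
      by rewrite mul0r !mulr0 expr0n/= addr0 mulr0 subr0 addr0 ler_wpM2l.
    have := sqr_facet_le j (x0 - a *m B) (- (b *m B)).
    rewrite re_functionalB re_functionalN -/t => tj.
    have d2 : d ^+ 2 = g j x0 ^+ 2 by rewrite -gd real_normK// num_real.
    have := ler_wpM2l (c0 j) tj.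
    set X := g j (a *m B) in tj *; set Z := g j (b *m B) in tj *.
    have X0 := sqr_ge0 X; have Z0 := sqr_ge0 Z; have := eP j.
    rewrite d2; nra.
  have := ler_sum (index_enum 'I_N) (fun j (_ : true) => term j).
  rewrite big_split big_split/= sumrN -!mulr_suml -!mulr_sumr.
  by rewrite (cE a) mulr0 subr0.
have L10 : 0 < L + 1 by rewrite ltr_wpDl.
rewrite -lerBrDl mulrAC ler_pdivrMr ?mulr_gt0//.
have := ler_wpM2l (ltW e0) hQ => /le_trans; apply.
rewrite mulrCA [leRHS]mulrC -mulrA [leRHS]mulrCA ler_pM2l//; lra.
Qed.
End Strong.

(** An imaginary displacement of norm [s] raises the norm only by order [s ^+ 2], whereas the
    inequality demands growth of order [s] to the power [alpha]. *)
Lemma facets_not_strong (b : 'rV[R]_k) (alpha r : R) :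
  b *m B <> 0 -> 1 <= alpha -> alpha < 2 -> 0 < r ->
  ~ (forall c, d `^ alpha + r * nrm (cvec 0 (c *m B)) `^ alpha
    <= nrm (cvec x0 (- (c *m B))) `^ alpha).
Proof.
move=> b0 a1 a2 r0 H.
set eta := nrm (cvec 0 (b *m B)).
have eta0 : 0 < eta.
  apply: nrm_gt0 => //; apply/eqP => E; apply: b0.
  by have [] := @cvec_inj R n 0 (b *m B) 0 0; rewrite ?cvec00.
have d2 : 0 < d ^+ 2 by rewrite exprn_gt0.
have a0 : 0 <= alpha by lra.
(* The 3 comes from [(1 + u) ^+ 2 <= 1 + 3 * u] for [u = s ^+ 2 / d ^+ 2] in [[0, 1]]. *)
pose C := 3 * d `^ alpha / d ^+ 2.
have C0 : 0 < C by rewrite divr_gt0// mulr_gt0// powR_gt0.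
have upper s : 0 < s -> s <= d -> r * s `^ alpha <= C * s ^+ 2.
  move=> s0 sd; have := H ((s / eta) *: b).
  have : nrm (cvec 0 ((s / eta) *: b *m B)) = s.
    rewrite -scalemxAl -{1}(scaler0 _ (s / eta)) nrm_cvecZ// ger0_norm.
      by rewrite divfK// gt_eqF.
    by rewrite divr_ge0// ltW.
  set p := _ *m B => pE; rewrite pE => Hp.
  rewrite -(lerD2l (d `^ alpha)) (le_trans Hp)//.
  pose u := s ^+ 2 / d ^+ 2.
  have u0 : 0 <= u by rewrite divr_ge0 ?sqr_ge0.
  have u1 : u <= 1.
    by rewrite ler_pdivrMr// mul1r lerXn2r ?nnegrE// ltW.
  have uE : u * d ^+ 2 = s ^+ 2 by rewrite divfK// gt_eqF.
  have du0 : 0 <= d * (1 + u) by rewrite mulr_ge0 ?addr_ge0// ltW.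
  (* Facet by facet, the squared modulus is at most [d ^+ 2 + s ^+ 2 = d ^+ 2 * (1 + u)], hence at
     most [(d * (1 + u)) ^+ 2]. *)
  have le_du : nrm (cvec x0 (- p)) <= d * (1 + u).
    apply: (facets_nrm_le hf) => [|j]; first exact: du0.
    rewrite -(@ler_pXn2r _ 2) ?nnegrE ?modulus_ge0//.
    rewrite functional_cvec// sqr_modulus.
    have h1 : g j x0 ^+ 2 <= d ^+ 2.
      rewrite -real_normK ?num_real// lerXn2r ?nnegrE ?(ltW d_gt0)//.
      by rewrite dE real_facet_le.
    have := sqr_facet_le j 0 p; rewrite pE re_functional0 expr0n/= add0r => h2.
    rewrite re_functionalN sqrrN exprMn; nra.
  have := ge0_ler_powR a0.
  move=> /(_ (nrm (cvec x0 (- p))) (d * (1 + u))).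
  rewrite !nnegrE nrm_ge0// => /(_ isT du0 le_du) /le_trans; apply.
  rewrite powRM ?addr_ge0 ?(ltW d_gt0)//.
  have -> : d `^ alpha + C * s ^+ 2 = d `^ alpha * (1 + 3 * u).
    by rewrite /C /u; field; rewrite gt_eqF.
  rewrite ler_wpM2l ?powR_ge0//.
  have : (1 + u) `^ alpha <= (1 + u) `^ 2 by apply: ler_powR; [rewrite lerDl | exact: ltW].
  by rewrite (powR_mulrn 2) ?addr_ge0// => /le_trans; apply; nra.
(* For [s <= q] the bound [C * s ^+ 2] is at most half of the left side of [upper], a
   contradiction. *)
pose q := (r / (2 * C)) `^ (2 - alpha)^-1.
have q0 : 0 < q by rewrite powR_gt0// divr_gt0// mulr_gt0.
pose s := Num.min d q.
have s0 : 0 < s by rewrite lt_min d_gt0.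
have := upper s s0; rewrite ge_min lexx => /(_ isT).
have -> : s ^+ 2 = s `^ alpha * s `^ (2 - alpha).
  rewrite -powRD; last by rewrite (gt_eqF s0) implybT.
  rewrite addrC subrK.
  by rewrite (powR_mulrn 2)// ltW.
rewrite mulrCA [leLHS]mulrC ler_pM2l ?powR_gt0//; apply/negP; rewrite -ltNge.
have b2 : 0 <= 2 - alpha by lra.
have sq : s `^ (2 - alpha) <= r / (2 * C).
  have -> : r / (2 * C) = q `^ (2 - alpha).
    rewrite -powRrM mulVf ?powRr1//; last by rewrite subr_eq0 gt_eqF.
    by rewrite ltW// divr_gt0// mulr_gt0.
  by apply: ge0_ler_powR => //; rewrite ?nnegrE ?(ltW s0) ?(ltW q0)// ge_min lexx orbT.
rewrite (le_lt_trans (ler_wpM2l (ltW C0) sq))//.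
have -> : C * (r / (2 * C)) = r / 2 by field; rewrite gt_eqF.
lra.
Qed.

End FacetsStrong.

(** * Real systems of vertices *)

Section VerticesMx.
Variables (R : realType) (n N : nat) (nrm : 'rV[R[i]]_n -> R).
Hypothesis hnrm : is_norm nrm.
Variable u : 'I_N -> 'rV[R[i]]_n.
Hypothesis hu : unit_ball_absconv nrm u setT.
Hypothesis ur : forall j, real_vector (u j).

Definition vertices_mx : 'M[R]_(N, n) := \matrix_j map_mx (@complex.Re R) (u j).
Local Notation U := vertices_mx.

Lemma vertices_rowE j : cvec (row j U) 0 = u j.
Proof.
rewrite rowK; have := ur j.
by rewrite {1}[u j]cvecK => /real_cvec <-; exact/esym/cvecK.
Qed.

Lemma vertices_nrm_le (c d : 'rV[R]_N) :
  nrm (cvec (c *m U) (d *m U)) <= \sum_j modulus (Complex (c 0 j) (d 0 j)).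
Proof.
rewrite cvec_mulmx (le_trans (nrm_sum hnrm _))// ler_sum// => j _.
rewrite nrmZ// ler_piMr ?modulus_ge0// vertices_rowE hu.
exists (fun l => (l == j)%:R).
  rewrite (bigD1 j) ?in_setT// eqxx Normc.normc1 big1 => [|l /andP[_ /negPf ->]].
    by rewrite /= addr0.
  exact: Normc.normc0.
rewrite (bigD1 j) ?in_setT// eqxx scale1r big1 => [|l /andP[_ /negPf ->]].
  by rewrite /= addr0.
by rewrite scale0r.
Qed.

(** Rescaling to the unit sphere makes the description of the ball applicable. With
    [vertices_nrm_le], the norm is the least sum of moduli over all representations by vertices, and
    it is attained. *)
Lemma vertices_decomp p q : exists c d : 'rV[R]_N,
  [/\ p = c *m U, q = d *m U &
      \sum_j modulus (Complex (c 0 j) (d 0 j)) <= nrm (cvec p q)].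
Proof.
have [v0|v0] := eqVneq (cvec p q) 0.
  have [-> ->] : p = 0 /\ q = 0 by apply: cvec_inj; rewrite v0 cvec00.
  exists 0, 0; rewrite !mul0mx; split=> //; rewrite cvec00 nrm0//.
  by rewrite big1// => j _; rewrite !mxE modulus_real normr0.
set t := nrm _; have t0 : 0 < t by apply: nrm_gt0.
have : nrm (Complex t^-1 0 *: cvec p q) <= 1.
  by rewrite nrmZ// modulus_real gtr0_norm ?invr_gt0// mulVf ?gt_eqF.
move=> /hu[a]; rewrite !(eq_bigl _ _ (@in_setT _)) => a1 aE.
exists (t *: \row_j complex.Re (a j)), (t *: \row_j complex.Im (a j)).
suff [-> ->] : p = t *: \row_j complex.Re (a j) *m U /\
               q = t *: \row_j complex.Im (a j) *m U.
  split=> //; rewrite -[leRHS]mulr1 (le_trans _ (ler_wpM2l (ltW t0) a1))//.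
  rewrite mulr_sumr; apply: ler_sum => j _; rewrite !mxE -[X in X * modulus _](gtr0_norm t0).
  rewrite -modulus_real -Normc.normcM; case: (a j) => x y.
  by rewrite le_eqVlt; apply/orP; left; apply/eqP; congr Num.sqrt => /=; ring.
apply: cvec_inj; rewrite -!scalemxAl -cvecZ cvec_mulmx.
rewrite -[LHS](scale1r) -[1 in LHS](_ : Complex t 0 * Complex t^-1 0 = 1).
  rewrite -scalerA aE; congr (_ *: _).
  by apply: eq_bigr => j _; rewrite !mxE vertices_rowE; case: (a j).
apply/eqP; rewrite eq_complex /=; apply/andP; split; apply/eqP.
  by rewrite mulr0 subr0 mulfV// gt_eqF.
by rewrite mulr0 mul0r addr0.
Qed.

End VerticesMx.

(** * Real vertices: linear growth *)

Section VerticesStrong.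
Variables (R : realType) (n N : nat) (nrm : 'rV[R[i]]_n -> R).
Hypothesis hnrm : is_norm nrm.
Variable U : 'M[R]_(N, n).
Hypothesis U_le : forall c d : 'rV[R]_N,
  nrm (cvec (c *m U) (d *m U)) <= \sum_j modulus (Complex (c 0 j) (d 0 j)).
Hypothesis U_decomp : forall p q, exists c d : 'rV[R]_N,
  [/\ p = c *m U, q = d *m U &
      \sum_j modulus (Complex (c 0 j) (d 0 j)) <= nrm (cvec p q)].

(** Conjugating the coefficients of an optimal representation preserves their moduli. *)
Lemma vertices_nrm_conj p q : nrm (cvec p (- q)) = nrm (cvec p q).
Proof.
have le p' q' : nrm (cvec p' (- q')) <= nrm (cvec p' q').
  have [c [d [-> -> h]]] := U_decomp p' q'; rewrite -mulNmx.
  rewrite (le_trans (U_le _ _))// (le_trans _ h)// ler_sum// => j _.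
  by rewrite !mxE /= sqrrN.
by apply/eqP; rewrite eq_le le -{1}[q]opprK le.
Qed.

Lemma real_vertices_nrm_le (c : 'rV[R]_N) : nrm (cvec (c *m U) 0) <= \sum_j `|c 0 j|.
Proof.
rewrite -(mul0mx _ U) (le_trans (U_le _ _))// ler_sum// => j _.
by rewrite mxE modulus_real.
Qed.

Variables (k : nat) (B : 'M[R]_(k, n)) (x0 : 'rV[R]_n) (d : R).
Hypothesis dE : d = nrm (cvec x0 0).
Hypothesis d_gt0 : 0 < d.
Hypothesis huniq : forall a, nrm (cvec (x0 - a *m B) 0) <= d -> a *m B = 0.
Hypothesis hmin : forall a, d <= nrm (cvec (x0 - a *m B) 0).

(* [phi] is a supporting functional of the ball at [x0] vanishing on [Y], and
   [F] lists the vertices (up to sign) of the face it exposes. Strict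
   complementarity makes [x0] a combination of vertices in [F] with nonzero
   coefficients, so a direction of [Y] in the span of [F] would keep the norm
   minimal, contradicting uniqueness. *)
Lemma exposed_face : exists (phi : 'rV[R]_n -> R) (h : R) (F : pred 'I_N),
  [/\ scalar phi /\ (forall a, phi (a *m B) = 0), 0 < h /\ phi x0 = h,
      forall j, d * `|phi (row j U)| <= h,
      forall j, ~~ F j -> d * `|phi (row j U)| < h &
      forall w : 'rV_N, (forall j, ~~ F j -> w 0 j = 0) ->
        (exists a, w *m U = a *m B) -> w *m U = 0].
Proof.
(* Functionals [w *m P *m y] vanish on the row space of [B]. Nonnegativity on the vectors [wv] says
   that [d * |phi u_j| <= phi x0] for every vertex. *)
pose P := cokermx B.
pose wv (i : 'I_1 + ('I_N + 'I_N)) : 'rV[R]_n :=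
  match i with
  | inl _ => x0
  | inr (inl j) => x0 - d *: row j U
  | inr (inr j) => x0 + d *: row j U
  end.
have [|y [c [c0 cE ay ac]]] := @tucker R 'cV[R]_n _ (fun i y => (wv i *m P *m y) 0 0).
  by move=> i t u v; rewrite mulmxDr -scalemxAr !mxE.
pose phi (w : 'rV[R]_n) := (w *m P *m y) 0 0.
have lphi : scalar phi by move=> t u v; rewrite /phi !mulmxDl -!scalemxAl !mxE.
have phiB a : phi (a *m B) = 0.
  by rewrite /phi -(mulmxA a) mulmx_coker mulmx0 mul0mx mxE.
have phiN v : phi (- v) = - phi v by rewrite /phi !mulNmx mxE.
have phiZ t v : phi (t *: v) = t * phi v by rewrite /phi -!scalemxAl mxE.
have phiD v w : phi (v + w) = phi v + phi w by rewrite /phi !mulmxDl mxE.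
pose l0 := c (inl ord0); pose lp j := c (inr (inl j)); pose lm j := c (inr (inr j)).
pose L := \sum_j (lp j + lm j).
pose e : 'rV[R]_N := \row_j (lp j - lm j).
have [D DE] : exists D, (l0 + L) *: x0 - d *: (e *m U) = D *m B.
  suff -> : (l0 + L) *: x0 - d *: (e *m U) = \sum_i c i *: wv i.
    apply/submxP; rewrite submxE; apply/eqP/rowP => j.
    apply: etrans (etrans (cE (delta_mx j 0)) _); last by rewrite mxE.
    rewrite mulmx_suml summxE; apply: eq_bigr => i _.
    by rewrite -scalemxAl -colE mxE [in RHS]mxE.
  rewrite !big_sumType /= big_ord1 -/l0 scalerDl -!addrA; congr (_ + _).
  rewrite -big_split/= /L scaler_suml mulmx_sum_row scaler_sumr -sumrB.
  apply: eq_bigr => j _; rewrite mxE -/(lp j) -/(lm j).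
  by apply/rowP => l; rewrite !mxE; ring.
have Le : \sum_j `|e 0 j| <= L.
  by apply: ler_sum => j _; rewrite mxE (le_trans (ler_normB _ _))// !ger0_norm// c0.
have L0 : 0 <= L by apply: sumr_ge0 => j _; rewrite addr_ge0 ?c0.
(* Otherwise [x0] would have distance at most [d * L / (l0 + L) < d] from [Y]. Strictness then gives
   [phi x0 > 0]. *)
have l00 : l0 = 0.
  apply/eqP; rewrite eq_le c0 andbT leNgt; apply/negP => l0_gt0.
  have t0 : 0 < l0 + L by rewrite ltr_pwDl.
  have := hmin ((l0 + L)^-1 *: D).
  have -> : x0 - (l0 + L)^-1 *: D *m B = (d / (l0 + L)) *: e *m U.
    rewrite -scalemxAl -DE scalerBr !scalerA mulVf ?gt_eqF// scale1r.
    by rewrite opprB addrC subrK mulrC -scalemxAl.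
  move=> /le_trans/(_ (real_vertices_nrm_le _)).
  under eq_bigr do rewrite mxE normrM.
  rewrite -mulr_sumr gtr0_norm ?divr_gt0// -mulrA ler_pMr// ler_pdivlMl// mulr1.
  by move=> /le_trans/(_ Le); lra.
have h0 : 0 < phi x0 by have := ac (inl ord0); rewrite -/l0 l00 addr0.
set h := phi x0 in h0 *.
pose psi j := d * phi (row j U).
have aP j : phi (wv (inr (inl j))) = h - psi j by rewrite /= phiD phiN phiZ.
have aM j : phi (wv (inr (inr j))) = h + psi j by rewrite /= phiD phiZ.
have psi_le j : `|psi j| <= h.
  have := ay (inr (inl j)); have := ay (inr (inr j)).
  rewrite -/(phi _) -/(phi _) aP aM ler_norml => *.
  by apply/andP; split; lra.
have compl i : c i * phi (wv i) = 0.
  have := cE y => /eqP; rewrite psumr_eq0 => [/allP/(_ i)|j _]; last first.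
    by rewrite mulr_ge0.
  by rewrite mem_index_enum => /(_ isT)/= /eqP.
(* On [F], complementary slackness forces [psi j = h] or [psi j = - h]; off [F], strictness gives
   [|psi j| < h]. *)
pose F j := (0 < lp j) || (0 < lm j).
have psiE j : d * `|phi (row j U)| = `|psi j| by rewrite normrM (gtr0_norm d_gt0).
have notF j : ~~ F j -> lp j = 0 /\ lm j = 0.
  rewrite negb_or -!leNgt => /andP[lp0 lm0].
  by split; apply/eqP; rewrite eq_le ?lp0 ?lm0 c0.
exists phi, h, F; split=> //.
- by move=> j; rewrite psiE.
- move=> j /notF[lp0 lm0]; rewrite psiE.
  have := ac (inr (inl j)); have := ac (inr (inr j)).
  rewrite -/(phi _) -/(phi _) -/(lp j) -/(lm j) lp0 lm0 aP aM ltr_norml => *.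
  by apply/andP; split; lra.
move=> w wF [a waB].
have [L_eq0|L_neq0] := eqVneq L 0.
  suff -> : w = 0 by rewrite mul0mx.
  apply/rowP => j; rewrite mxE wF//.
  move/eqP: L_eq0; rewrite psumr_eq0 => [/allP/(_ j)|i _]; last by rewrite addr_ge0 ?c0.
  rewrite mem_index_enum => /(_ isT)/= /eqP lpm.
  have := c0 (inr (inl j)); have := c0 (inr (inr j)); rewrite -/(lp j) -/(lm j) => *.
  by rewrite /F negb_or -!leNgt; apply/andP; split; lra.
have L_gt0 : 0 < L by rewrite lt_neqAle eq_sym L_neq0.
(* On [F] the coefficient [z 0 j] is nonzero with the sign of [psi j], so small multiples of [w]
   keep that sign. *)
pose z := (d / L) *: e.
have zE : z *m U = x0 - (L^-1 *: D) *m B.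
  rewrite -scalemxAl -DE l00 add0r scalerBr !scalerA mulVf// scale1r.
  by rewrite opprB addrC subrK mulrC -scalemxAl.
have [j|eps eps0 epsP] := @uniform_threshold R 'I_N
    (fun j t => h * `|z 0 j + t * w 0 j| <= psi j * (z 0 j + t * w 0 j)).
  have [Fj|/[dup] Fj /notF[lp0 lm0]] := boolP (F j); last first.
    exists 1 => // t _; rewrite wF// !mxE lp0 lm0 subrr !mulr0 addr0.
    by rewrite normr0 !mulr0.
  have lpsi : (0 < lp j /\ psi j = h /\ lm j = 0) \/
              (0 < lm j /\ psi j = - h /\ lp j = 0).
    have := compl (inr (inl j)); rewrite aP -/(lp j) => cp.
    have := compl (inr (inr j)); rewrite aM -/(lm j) => cm.
    case/orP: Fj => Fj; [left|right]; split=> //.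
      have E : psi j = h.
        by move/eqP: cp; rewrite mulf_eq0 gt_eqF//= => /eqP; lra.
      split=> //; move/eqP: cm; rewrite E mulf_eq0 => /orP[/eqP//|/eqP]; lra.
    have E : psi j = - h.
      by move/eqP: cm; rewrite mulf_eq0 gt_eqF//= => /eqP; lra.
    split=> //; move/eqP: cp; rewrite E mulf_eq0 => /orP[/eqP//|/eqP]; lra.
  have zj_neq0 : 0 < `|z 0 j|.
    rewrite normr_gt0 !mxE mulf_neq0//; first by rewrite gt_eqF ?divr_gt0.
    case: lpsi => [[l1 [_ l2]]|[l1 [_ l2]]]; rewrite l2 ?subr0 ?add0r ?sub0r.
      by rewrite gt_eqF.
    by rewrite oppr_eq0 gt_eqF.
  exists (`|z 0 j| / (1 + `|w 0 j|)) => [|t /andP[t0]].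
    by rewrite divr_gt0// ltr_pwDl.
  rewrite ler_pdivlMr ?ltr_pwDl// => te.
  have : `|t * w 0 j| <= `|z 0 j| by rewrite normrM (ger0_norm t0); nra.
  rewrite ler_norml => /andP[tw1 tw2].
  have dL : 0 < d / L by rewrite divr_gt0.
  case: lpsi => [[l1 [-> l2]]|[l1 [-> l2]]].
    have z0 : 0 <= z 0 j by rewrite !mxE l2 subr0 mulr_ge0 ?ltW.
    rewrite (ger0_norm z0) in tw1; rewrite ger0_norm//; lra.
  have z0 : z 0 j <= 0 by rewrite !mxE l2 sub0r mulr_ge0_le0 ?ltW// oppr_lt0.
  rewrite (ler0_norm z0) in tw2; rewrite ler0_norm; lra.
(* The sign agreement bounds [h] times the coefficient sum by [d * phi x0 = d * h], so the residual
   has norm at most [d]. Comparing [t = 0] with [t = eps] gives [a *m B = 0]. *)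
have shift t : 0 <= t <= eps -> (L^-1 *: D - t *: a) *m B = 0.
  move=> /epsP ht; apply: huniq.
  have E : x0 - (L^-1 *: D - t *: a) *m B = (z + t *: w) *m U.
    rewrite mulmxBl opprB addrCA addrA [RHS]mulmxDl zE -!scalemxAl waB.
    by rewrite -addrA addrC.
  rewrite E (le_trans (real_vertices_nrm_le _))//.
  rewrite -(ler_pM2l h0) mulr_sumr.
  apply: (@le_trans _ _ (\sum_j psi j * (z + t *: w) 0 j)).
    by apply: ler_sum => j _; have := ht j; rewrite !mxE.
  have -> : \sum_j psi j * (z + t *: w) 0 j = d * phi ((z + t *: w) *m U).
    rewrite mulmx_sum_row scalar_lincomb// mulr_sumr.
    by apply: eq_bigr => j _; rewrite /psi; ring.
  by rewrite -E phiD phiN phiB subr0 mulrC.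
have := shift 0; rewrite lexx ltW// scale0r subr0 => /(_ isT) D0.
have := shift eps; rewrite lexx ltW// => /(_ isT); rewrite mulmxBl D0 sub0r.
by move/eqP; rewrite oppr_eq0 -scalemxAl scaler_eq0 gt_eqF//= waB => /eqP.
Qed.

Lemma vertices_strong : exists2 r, 0 < r & forall a b,
  d + r * nrm (cvec (a *m B) (b *m B)) <= nrm (cvec (x0 - a *m B) (- (b *m B))).
Proof.
have [phi [h [F [[lphi phiB] [h0 phix] phi_le phi_lt face]]]] := exposed_face.
have [j|e0 e00 eP] := @uniform_threshold R 'I_N
    (fun j t => ~~ F j -> t <= h - d * `|phi (row j U)|).
  have [Fj|Fj] := boolP (F j); first by exists 1.
  exists (h - d * `|phi (row j U)|) => [|t /andP[]//].
  by rewrite subr_gt0 phi_lt.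
have {}eP j : ~~ F j -> e0 <= h - d * `|phi (row j U)|.
  by apply: eP; rewrite lexx ltW.
(* Applying [phi] gives [h = \sum_j c_j phi(u_j)], so the right side is at least the sum of the
   moduli weighted by [h - d * |phi u_j|]. *)
have excess (c e : 'rV[R]_N) a : c *m U = x0 - a *m B ->
    e0 * (\sum_j if F j then 0 else modulus (Complex (c 0 j) (e 0 j)))
    <= h * (\sum_j modulus (Complex (c 0 j) (e 0 j)) - d).
  move=> cU.
  have phicU : h = \sum_j c 0 j * phi (row j U).
    rewrite -scalar_lincomb// -mulmx_sum_row cU -mulNmx addrC -[x0]scale1r.
    have := lphi 1 x0 ((- a) *m B); rewrite phiB addr0 mul1r phix => <-.
    by rewrite addrC.
  rewrite mulrBr [X in _ - X]mulrC {2}phicU !mulr_sumr -sumrB ler_sum// => j _.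
  have hphi : c 0 j * phi (row j U) <= `|phi (row j U)| * modulus (Complex (c 0 j) (e 0 j)).
    rewrite (le_trans (ler_norm _))// normrM mulrC ler_wpM2l//.
    exact: (norm_Re_le_modulus (Complex _ _)).
  have := ler_wpM2l (ltW d_gt0) hphi; move: (modulus_ge0 (Complex (c 0 j) (e 0 j))).
  set m := modulus _ => m0 {}hphi.
  have [Fj|Fj] := boolP (F j); have := phi_le j; nra || have := eP j Fj; nra.
have [c1 [e1 [x0E _]]] := U_decomp x0 0; rewrite -dE => c1d.
(* An optimal representation of [x0] has no excess, hence is supported on [F]. *)
have c1F j : ~~ F j -> c1 0 j = 0.
  move=> Fj; have := excess c1 e1 0; rewrite mul0mx subr0 => /(_ (esym x0E)) ex.
  apply/eqP; rewrite -normr_le0; apply: le_trans (norm_Re_le_modulus (Complex _ (e1 0 j))) _.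
  have : e0 * (\sum_j if F j then 0 else modulus (Complex (c1 0 j) (e1 0 j))) <= 0.
    by rewrite (le_trans ex)// pmulr_rle0// subr_le0.
  rewrite pmulr_rle0// (bigD1 j)//= (negPf Fj) => le0.
  apply: le_trans le0; rewrite lerDl sumr_ge0// => l _.
  by case: ifP => // _; apply: sqrtr_ge0.
pose W := kermx (U *m cokermx B).
pose Df : 'M[R]_N := diag_mx (\row_j if F j then 0 else 1).
have DfE (w : 'rV_N) j : (w *m Df) 0 j = if F j then 0 else w 0 j.
  by rewrite mul_mx_diag !mxE; case: ifP => _; rewrite ?mulr0 ?mulr1.
(* [W] spans the coefficient vectors representing elements of [Y], and [Df] erases the coordinates
   in [F]. By [face], the remaining coordinates determine the element. *)
have [v vW|T TE] := @kermx_sub_factor R N N n (W *m Df) (W *m U).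
  rewrite mulmxA; apply: face => [j Fj|].
    by have := DfE (v *m W) j; rewrite -mulmxA vW mxE (negPf Fj).
  by apply/submxP; rewrite submxE -[_ *m U *m _]mulmxA -[v *m W *m _]mulmxA mulmx_ker mulmx0.
have factor (w : 'rV_N) a : w *m U = a *m B -> w *m U = w *m Df *m T.
  move=> wU; have /submxP[v ->] : (w <= W)%MS.
    by apply/sub_kermxP; rewrite mulmxA wU -mulmxA mulmx_coker mulmx0.
  by rewrite -[LHS]mulmxA TE !mulmxA.
have [K K0 KP] := nrm_mulmx_bound hnrm T.
exists (e0 / (K * h)) => [|a b]; first by rewrite divr_gt0// mulr_gt0.
have [c [e [cE eE le_ce]]] := U_decomp (x0 - a *m B) (- (b *m B)).
set t := nrm (cvec (x0 - _) _) in le_ce *.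
pose S := \sum_j if F j then 0 else modulus (Complex (c 0 j) (e 0 j)).
have eS : e0 * S <= h * (t - d).
  by rewrite (le_trans (excess c e a _))// ler_pM2l// lerB.
have nrmS : nrm (cvec (a *m B) (b *m B)) <= K * S.
  (* The difference [c - c1] represents an element of [Y], and [c1] contributes nothing outside
     [F]. *)
  have aE : - (a *m B) = c *m Df *m T.
    have : (c - c1) *m U = (- a) *m B.
      by rewrite mulmxBl -cE -x0E addrC addKr mulNmx.
    move=> cc1; rewrite -mulNmx -cc1 (factor _ _ cc1).
    congr (_ *m _); apply/rowP => j; rewrite !DfE !mxE.
    by case: ifP => // /negbT /c1F ->; rewrite subr0.
  have bE : - (b *m B) = e *m Df *m T.
    by rewrite eE; apply: (factor _ (- b)); rewrite -eE mulNmx.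
  rewrite -nrmN// cvecN aE bE (le_trans (KP _ _))// ler_pM2l// ler_sum// => j _.
  rewrite !DfE; case: ifP => // _.
  by rewrite modulus_real normr0.
rewrite -lerBrDl -(ler_pM2l h0) (le_trans _ eS)//.
set m := nrm _ in nrmS *.
have -> : h * (e0 / (K * h) * m) = e0 * (m / K) by field; rewrite !gt_eqF.
by rewrite ler_pM2l// ler_pdivrMr// mulrC.
Qed.

End VerticesStrong.

(** * Best approximation *)

Lemma real_polytope_nrm_conj (R : realType) (n : nat) (nrm : 'rV[R[i]]_n -> R) :
  is_norm nrm ->
  has_real_essential_vertices nrm \/ has_real_essential_facets nrm ->
  forall p q, nrm (cvec p (- q)) = nrm (cvec p q).
Proof.
move=> hnrm [[N [u [[hu _] ur]]]|[N [f [[hf _] fr]]]].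
  exact: vertices_nrm_conj (vertices_nrm_le hnrm hu ur) (vertices_decomp hnrm hu ur).
exact: facets_nrm_conj hf fr.
Qed.

Lemma real_polytope_strong (R : realType) (n k : nat) (nrm : 'rV[R[i]]_n -> R)
    (B : 'M[R]_(k, n)) (x0 : 'rV[R]_n) :
  is_norm nrm ->
  has_real_essential_vertices nrm \/ has_real_essential_facets nrm ->
  0 < nrm (cvec x0 0) ->
  (forall a, nrm (cvec (x0 - a *m B) 0) <= nrm (cvec x0 0) -> a *m B = 0) ->
  (forall a b, nrm (cvec x0 0) <= nrm (cvec (x0 - a *m B) (- (b *m B)))) ->
  exists2 r, 0 < r & forall a b,
    nrm (cvec x0 0) ^+ 2 + r * nrm (cvec (a *m B) (b *m B)) ^+ 2
      <= nrm (cvec (x0 - a *m B) (- (b *m B))) ^+ 2.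
Proof.
move=> hnrm hpoly d0 huniq hmin.
case: hpoly => [[N [u [[hu _] ur]]]|[N [f [[hf _] fr]]]]; last first.
  exact: (facets_strong hnrm hf fr erefl).
have [a|r r0 rP] := vertices_strong hnrm (vertices_nrm_le hnrm hu ur)
  (vertices_decomp hnrm hu ur) erefl d0 huniq.
  by have := hmin a 0; rewrite mul0mx oppr0.
(* Exponent 1 implies exponent 2 through [d ^+ 2 + m ^+ 2 <= (d + m) ^+ 2]. *)
exists (r ^+ 2) => [|a b]; first exact: exprn_gt0.
rewrite -exprMn; have := rP a b.
have m0 : 0 <= r * nrm (cvec (a *m B) (b *m B)) by rewrite mulr_ge0 ?nrm_ge0 ?ltW.
set m := r * _ in m0 *; set d := nrm (cvec x0 0) in d0 *; set t := nrm _ => le_t.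
have t0 : 0 <= t := nrm_ge0 hnrm _.
have : (d + m) ^+ 2 <= t ^+ 2 by rewrite lerXn2r ?nnegrE ?addr_ge0 ?(ltW d0).
by apply: le_trans; rewrite sqrrD lerD2r lerDl mulrn_wge0// mulr_ge0// ltW.
Qed.

Theorem theorem4p6 (R : realType) (n : nat) (hn : (2 <= n)%N)
    (nrm : 'rV[R[i]]_n -> R) (hnrm : is_norm nrm)
    (hpoly :
      (complex_polytope_norm nrm /\ has_real_essential_vertices nrm) \/
      (adjoint_complex_polytope_norm nrm /\ has_real_essential_facets nrm))
    (Y : {vspace 'rV[R[i]]_n}) (hY0 : Y <> 0%VS) (hYT : Y <> fullv)
    (hYreal : real_subspace Y)
    (x : 'rV[R[i]]_n) (hxY : x \notin Y) (hxreal : real_vector x)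
    (y0 : 'rV[R[i]]_n) (hy0 : unique_best_approximation nrm Y x y0) :
  real_vector y0 /\
  strongly_unique_best_approximation nrm 2 Y x y0 /\
  (adjoint_complex_polytope_norm nrm /\ has_real_essential_facets nrm ->
   forall alpha : R, 1 <= alpha -> alpha < 2 ->
     ~ strongly_unique_best_approximation nrm alpha Y x y0).
Proof.
have {}hpoly : has_real_essential_vertices nrm \/ has_real_essential_facets nrm.
  by case: hpoly => [[_ h]|[_ h]]; [left|right].
have [k [B YB]] := real_subspace_mx hYreal.
have [[y0Y y0best] y0uniq] := hy0.
have [p [q xE]] := cvecP x; have q0 : q = 0 by apply/(real_cvec p); rewrite -xE.
rewrite q0 in xE.
have [a0 [b0 y0E]] := (YB y0).1 y0Y.
(* The conjugate of [y0] lies in [Y] and is equally close to the real vector [x], so it equals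
   [y0]. *)
have b0B : b0 *m B = 0.
  have : cvec (a0 *m B) (- b0 *m B) = y0.
    apply: y0uniq; split=> [|y yY]; first by apply/YB; exists a0, (- b0).
    apply: le_trans (y0best y yY).
    by rewrite mulNmx xE y0E !cvecB !sub0r opprK real_polytope_nrm_conj.
  rewrite y0E => /cvec_inj[_ /eqP]; rewrite mulNmx eq_sym -addr_eq0 -mulr2n.
  by move=> /eqP E; apply/rowP => j; have /rowP/(_ j) := E; rewrite !mxE; lra.
rewrite b0B in y0E.
pose x0 := p - a0 *m B.
have x0E : x - y0 = cvec x0 0 by rewrite xE y0E cvecB subr0.
set d := nrm (cvec x0 0).
have d0 : 0 < d.
  apply: nrm_gt0 => //; rewrite -x0E subr_eq0.
  by apply: contraNneq hxY => ->.
have subE a b : x - (y0 + cvec (a *m B) (b *m B)) = cvec (x0 - a *m B) (- (b *m B)).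
  by rewrite opprD addrA x0E cvecB sub0r.
have inY a b : y0 + cvec (a *m B) (b *m B) \in Y.
  by apply: rpredD => //; apply/YB; exists a, b.
have hmin a b : d <= nrm (cvec (x0 - a *m B) (- (b *m B))).
  by rewrite -subE /d -x0E y0best.
have huniq a : nrm (cvec (x0 - a *m B) 0) <= d -> a *m B = 0.
  move=> le_d; have : y0 + cvec (a *m B) (0 *m B) = y0.
    apply: y0uniq; split=> // y yY.
    rewrite subE mul0mx oppr0 (le_trans le_d)// /d -x0E; exact: y0best.
  move=> /eqP; rewrite -subr_eq0 addrC addKr mul0mx -cvec00 => /eqP.
  by case/cvec_inj.
split; first by rewrite y0E; apply/real_cvec.
split.
  split=> //; have [r r0 rP] := real_polytope_strong hnrm hpoly d0 huniq hmin.
  exists r => // y yY.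
  have [a [b yE]] : exists a b, y - y0 = cvec (a *m B) (b *m B).
    by apply/YB; apply: rpredB.
  have -> : y = y0 + cvec (a *m B) (b *m B) by rewrite -yE addrC subrK.
  by rewrite subE x0E [y0 + _]addrC addrK !(powR_mulrn 2) ?nrm_ge0 ?rP.
move=> [_ [N [f [[hf _] fr]]]] alpha a1 a2 [_ [r r0 rP]].
have [b bB] : exists b : 'rV_k, b *m B <> 0.
  apply/existsNP => B0; apply: hY0; apply/eqP; rewrite -subv0.
  apply/subvP => y /YB[a [b ->]].
  by rewrite (B0 a) (B0 b) cvec00 memv0.
(* The competitors are the purely imaginary displacements [y0 + i (c *m B)]. *)
apply: (facets_not_strong hnrm hf fr erefl d0 bB a1 a2 r0) => c.
have := rP _ (inY 0 c).
by rewrite subE x0E addrC [y0 + _]addrC addrK mul0mx subr0 addrC.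
Qed.
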